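(* Suppose $N>M>2$ and each entry $w_i$ of the weight vector $\vec w=(w_1,\dots,w_N)$ (positive entries summing to $1$) satisfies $$w_i\in\left[\frac{M-1}{M(N-1)},\ \frac{N-2M+M^2}{M^2(N-1)}\right].$$ If one sets $$p_i=\frac{M(N-1)}{N-M}\,w_i-\frac{M-1}{N-M},\qquad i\in[N],$$ then the sortition algorithm Cumulative Rejection Sampling with these $p_i$ is fair, i.e. $\mathbb{E}[g(n;\mathcal{M})]=w_n$ for all $n\in[N]$.
   Context: Setting: there are $N$ participants, indexed by $[N]=\{1,\dots,N\}$, with positive weights $w_i$, $\sum_i w_i=1$. A sortition algorithm outputs a random committee $\mathcal{M}\subseteq[N]$ of size $M$ and unnormalized weights $g_n$; the voting power is $g(n;\mathcal{M})=g_n/\sum_{m\in\mathcal{M}}g_m$ for $n\in\mathcal{M}$ and $g(n;\mathcal{M})=0$ for $n\notin\mathcal{M}$. The algorithm is fair (on $\vec w$) if $\mathbb{E}[g(n;\mathcal{M})]=w_n$ for all $n\in[N]$. Algorithm Cumulative Rejection Sampling (input $\vec w$, $M$): (1) compute the numbers $p_i$ from $\vec w$ and $M$; (2) generate a uniformly random $M$-element subset $\mathcal{M}=\{m_1,\dots,m_M\}$ of $[N]$; (3) generate an independent $U$ uniform on $[0,1]$; if $U\ge\sum_{j=1}^M p_{m_j}$, reject $\mathcal{M}$ and return to step (2) with fresh independent randomness; (4) otherwise output $\mathcal{M}$ with $g_m=1$ for $m\in\mathcal{M}$ and $g_m=0$ for $m\notin\mathcal{M}$. *)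

(* Defs.v *)
From HB Require Import structures.
From mathcomp Require Import all_boot all_order all_algebra finmap.
From mathcomp Require Import all_classical all_reals all_analysis.

Set Implicit Arguments.
Unset Strict Implicit.
Unset Printing Implicit Defensive.

Import Order.TTheory GRing.Theory Num.Theory.

Local Open Scope classical_set_scope.
Local Open Scope ring_scope.

(* Participants are indexed by ['I_N], i.e. 0, ..., N-1.  An outcome consists
   of the committee and the unnormalized weights g. *)
Definition outcome (R : realType) (N : nat) : Type :=
  ({set 'I_N} * ('I_N -> R))%type.

Definition voting_power (R : realType) (N : nat) (o : outcome R N) (n : 'I_N)
    : R :=
  if n \in o.1 then o.2 n / \sum_(m in o.1) o.2 m else 0.

(* [None] stands for a run that never outputs a committee; nobody has any
   voting power in such a run, so fairness for weights summing to 1 forces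
   these runs to have probability 0. *)
Definition run_voting_power (R : realType) (N : nat) (o : option (outcome R N))
    (n : 'I_N) : R :=
  if o is Some o' then voting_power o' n else 0.

Definition fair (R : realType) (N : nat) (d : measure_display)
    (T : measurableType d) (P : probability T R)
    (out : T -> option (outcome R N)) (w : 'I_N -> R) : Prop :=
  forall n : 'I_N, 'E_P[fun x => run_voting_power (out x) n]%E = (w n)%:E.

Definition mutually_independent (R : realType) (d : measure_display)
    (T : measurableType d) (P : probability T R) (I : choiceType)
    (F : I -> set (set T)) : Prop :=
  forall (J : {fset I}) (E : I -> set T),
    (forall i, i \in J -> F i (E i)) ->
    P (\bigcap_(i in [set` J]) E i) = (\prod_(i <- J) P (E i))%E.

Section CumulativeRejectionSampling.
Context {R : realType} {N : nat} {d : measure_display} {T : measurableType d}.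
Variable P : probability T R.

(* Round t draws the candidate committee [S t] and the number [U t]. *)
Variables (S : nat -> T -> {set 'I_N}) (U : nat -> {RV P >-> R}).

Definition round_events (i : nat + nat) : set (set T) :=
  match i with
  | inl t => preimage_set_system setT (S t) setT
  | inr t => preimage_set_system setT (U t) measurable
  end.

Definition crs_randomness (M : nat) : Prop :=
  [/\ forall t (C : {set 'I_N}), measurable (S t @^-1` [set C]),
      forall t (C : {set 'I_N}),
        P (S t @^-1` [set C]) =
          (if #|C| == M then ('C(N, M)%:R)^-1 else 0)%:E,
      forall t (A : set R), measurable A ->
        distribution P (U t) A = uniform_prob (@ltr01 R) A
    & mutually_independent P round_events].

Variable p : 'I_N -> R.

Definition accepts (x : T) (t : nat) : bool :=
  U t x < \sum_(j in S t x) p j.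

Definition cumulative_rejection_sampling (x : T) : option (outcome R N) :=
  match pselect (exists t, accepts x t) with
  | left h =>
      let C := S (ex_minn h) x in
      Some (C, fun m => if m \in C then 1 else 0)
  | right _ => None
  end.

End CumulativeRejectionSampling.

(* Main.v *)
(** Each round outputs the committee [C] with probability [a C * ps C], where
    [a] is the uniform law on the [M]-subsets and [ps C] the sum of the [p j]
    over [C]; the rounds being independent, the committee finally output is [C]
    with probability [a C * ps C / q], by summing a geometric series with
    acceptance probability [q = M / N].  The bounds on [w] say exactly that
    [0 <= p i <= 1 / M], so that [ps C] is a probability.  Each other
    participant belongs to a fraction [(M - 1) / (N - 1)] of the committees
    containing [n], so [n] has expected voting power
    [(p n + (1 - p n) * (M - 1) / (N - 1)) / M], an affine function of [p n],
    which the choice of [p] makes equal to [w n]. *)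

Require Import Defs.
From HB Require Import structures.
From mathcomp Require Import all_boot all_order all_algebra finmap.
From mathcomp Require Import all_classical all_reals all_analysis.
From mathcomp Require Import measurable_realfun ring.
Import Order.TTheory GRing.Theory Num.Theory.
Import numFieldNormedType.Exports.
Local Open Scope ring_scope.

(** * Counting subsets of a given size *)

Section Subsets.
Variable T : finType.

(** Adjoining [B] is a bijection from the subsets of its complement with [k - #|B|] elements. For
    [k < #|B|] the truncated subtraction would give a binomial equal to 1, while no such [C]
    exists. *)
Lemma card_supset_draws (B : {set T}) (k : nat) : (#|B| <= k)%N ->
  #|[set C : {set T} | (B \subset C) && (#|C| == k)]| =
  'C(#|T| - #|B|, k - #|B|).
Proof.
move=> Bk.
have -> : (#|T| - #|B| = #|~: B|)%N by rewrite [RHS]cardsCs finset.setCK.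
rewrite -cards_draws.
set D := [set A : {set T} | A \subset ~: B & _].
rewrite -(card_in_imset (f := fun A => A :|: B) (D := D)); last first.
  move=> A1 A2; rewrite !inE => /andP[A1B _] /andP[A2B _] /setP e.
  apply/setP => x; have := e x; rewrite !inE.
  case: (boolP (x \in B)) => [xB _|]; last by rewrite !orbF.
  have notin (A : {set T}) : A \subset ~: B -> x \notin A.
    by move=> /fintype.subsetP AB; apply/negP => /AB; rewrite inE xB.
  by rewrite (negPf (notin _ A1B)) (negPf (notin _ A2B)).
apply: eq_card => C; rewrite inE; apply/andP/imsetP => [[BC /eqP Ck]|[A]].
  exists (C :\: B); last first.
    rewrite finset.setUC finset.setDE finset.setUIr finset.setUCr finset.setIT.
    exact/esym/finset.setUidPr.
  by rewrite inE finset.setDE finset.subsetIr /= -finset.setDE cardsD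
    (finset.setIidPr BC) Ck.
rewrite inE => /andP[AB /eqP Ak] ->; split; first exact: finset.subsetUr.
rewrite cardsU Ak (_ : A :&: B = finset.set0) ?cards0 ?subn0 ?subnK//.
by apply/eqP; rewrite finset.setI_eq0 -(finset.setCK B) -finset.subsets_disjoint.
Qed.

(** Double counting: once the sums are exchanged, [p j] occurs once per admissible [C] that contains
    [j]. *)
Lemma sum_supset_draws (R : pzSemiRingType) (B : {set T}) (k : nat) (p : T -> R) :
  \sum_(C : {set T} | (B \subset C) && (#|C| == k)) \sum_(j in C) p j =
  \sum_j p j * #|[set C : {set T} | (j |: B \subset C) && (#|C| == k)]|%:R.
Proof.
rewrite (exchange_big_dep predT) //=; apply: eq_bigr => j _.
rewrite sumr_const mulr_natr; congr (_ *+ _).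
apply: eq_card => C; rewrite !inE finset.subUset finset.sub1set.
by rewrite !unfold_in /= andbC andbA.
Qed.

End Subsets.

Lemma uniform_prob_lt (R : realType) (s : R) : 0 <= s <= 1 ->
  uniform_prob (@ltr01 R) `]-oo, s[%classic = s%:E.
Proof.
move=> /andP[s0 s1]; rewrite /uniform_prob integral_uniform_pdf.
have -> : (`]-oo, s[ `&` `[0, 1] = `[0, s[ :> set R)%classic.
  apply/seteqP; split => x /=; rewrite !in_itv /=.
    by case=> -> /andP[->].
  by move=> /andP[x0 xs]; rewrite x0 xs (ltW (lt_le_trans xs s1)).
rewrite (eq_integral (fun=> 1%:E)); last first.
  move=> x; rewrite inE /= in_itv /= => /andP[x0 xs].
  by rewrite /uniform_pdf x0 (ltW (lt_le_trans xs s1)) subr0 invr1.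
rewrite integral_cst//= lebesgue_measure_itv/= lte_fin mul1e.
by case: ltgtP s0 => // [|<-]; rewrite ?sube0.
Qed.

(** * Expectations and probabilities as finite sums *)

Section TotalProbability.
Context {R : realType} {d : measure_display} {T : measurableType d}.
Context (P : probability T R) {I : finType} (X : T -> I).
Hypothesis mX : forall i, measurable (X @^-1` [set i])%classic.

Lemma expectation_sum_indic (v : I -> R) (A : I -> set T) :
  (forall i, 0 <= v i) -> (forall i, measurable (A i)) ->
  'E_P[fun x => (\sum_i v i * \1_(A i) x)%R]%E = (\sum_i (v i)%:E * P (A i))%E.
Proof.
move=> v0 mA; rewrite unlock.
under eq_integral do rewrite -sumEFin.
rewrite ge0_integral_sum//.
- apply: eq_bigr => i _; under eq_integral do rewrite EFinM.
  rewrite ge0_integralZl_EFin// ?integral_indic// ?setIT//.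
  by apply/measurable_EFinP.
- by move=> i; apply/measurable_EFinP; apply: measurable_funM.
- by move=> i x _; rewrite lee_fin mulr_ge0.
Qed.

Lemma total_probability (A : set T) : measurable A ->
  (P A = \sum_i P (A `&` X @^-1` [set i])%classic)%E.
Proof.
move=> mA; rewrite -(expectation_indic P mA).
rewrite (eq_bigr (fun i => 1%:E * P (A `&` X @^-1` [set i])%classic)%E);
  last by move=> i _; rewrite mul1e.
rewrite -(expectation_sum_indic (fun=> 1)) //; last first.
  by move=> i; apply: measurableI.
congr expectation.body; apply/funext => x.
rewrite (bigD1 (X x)) //= big1 ?addr0 => [|i iX]; last first.
  by rewrite mul1r indicE memNset // => -[_] /= /eqP; rewrite eq_sym (negPf iX).
by rewrite mul1r !indicE in_setI [X in _ && X]mem_set ?andbT.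
Qed.

End TotalProbability.

(** * Law of the committee output by rejection sampling *)

Section RejectionSampling.
Context {R : realType} {N : nat} {d : measure_display} {T : measurableType d}.
Variables (P : probability T R) (S : nat -> T -> {set 'I_N}).
Variables (U : nat -> {RV P >-> R}) (M : nat) (p : 'I_N -> R).
Hypothesis hrand : crs_randomness S U M.
Hypothesis hp : forall C : {set 'I_N}, #|C| = M -> 0 <= \sum_(j in C) p j <= 1.

Let ps (C : {set 'I_N}) := \sum_(j in C) p j.
Let a (C : {set 'I_N}) : R := if #|C| == M then ('C(N, M)%:R)^-1 else 0.
Let q := \sum_(C : {set 'I_N}) a C * ps C.

Definition rejected (k : nat) : set T :=
  [set x | forall t, (t < k)%N -> ~~ accepts S U p x t]%classic.

Let mS t C : measurable (S t @^-1` [set C])%classic.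
Proof. by case: hrand. Qed.

Let mU t (A : set R) : measurable A -> measurable (U t @^-1` A)%classic.
Proof.
by move=> mA; rewrite -[X in measurable X]setTI; exact: measurable_funPT.
Qed.

Let PU t (C : {set 'I_N}) : #|C| = M -> P (U t @^-1` `]-oo, ps C[)%classic = (ps C)%:E.
Proof.
move=> CM; case: hrand => _ _ hU _.
rewrite -[LHS]/(distribution P (U t) `]-oo, ps C[%classic) hU//.
exact/uniform_prob_lt/hp.
Qed.

(** [hp] bounds [ps C] only for committees of size [M]; for any other size [a C] is 0 and both sides
    vanish. The left side stays a product, since independence enters only in [rejection_prefix]. *)
Lemma acceptance_mass t (C : {set 'I_N}) :
  (P (S t @^-1` [set C]) * P (U t @^-1` `]-oo, ps C[) = (a C * ps C)%:E)%classic%E.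
Proof.
case: hrand => _ -> _ _; rewrite /a.
case: eqP => [CM|_]; last by rewrite mul0e mul0r.
by rewrite PU// -EFinM.
Qed.

Lemma rejection_mass t (C : {set 'I_N}) :
  (P (S t @^-1` [set C]) * P (U t @^-1` ~` `]-oo, ps C[) =
   (a C * (1 - ps C))%:E)%classic%E.
Proof.
case: hrand => _ -> _ _; rewrite /a.
case: eqP => [CM|_]; last by rewrite mul0e mul0r.
rewrite preimage_setC probability_setC; last exact: (mU t `]-oo, ps C[%classic).
by rewrite PU.
Qed.

(** [a] is the law of [S 0], so no subsets have to be counted. *)
Lemma sum_committee_mass : \sum_C a C = 1.
Proof.
apply: EFin_inj; rewrite -sumEFin -(probability_setT P).
rewrite (total_probability P (S 0%N) (mS 0%N))//.
by apply: eq_bigr => C _; rewrite setTI; case: hrand => _ ->.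
Qed.

Lemma measurable_rejected k : measurable (rejected k).
Proof.
(* Splitting over the value of [S t] makes the acceptance threshold constant on each piece. *)
have -> : rejected k = (\bigcap_(t in `I_k)
    ~` \bigcup_(C in setT) (S t @^-1` [set C] `&` U t @^-1` `]-oo, ps C[))%classic.
  apply/seteqP; split => x /= h t /= tk; have := h t tk; rewrite /accepts.
    move=> /negP nacc -[C _ [/= SC]]; rewrite in_itv /= -/(ps (S t x)) => lt.
    by apply: nacc; rewrite -/(ps (S t x)) SC.
  move=> nacc; apply/negP => acc; apply: nacc; exists (S t x) => //.
apply: fin_bigcap_measurable => [|t _]; first exact: finite_II.
apply: measurableC.
apply: fin_bigcup_measurable => // C _.
by apply: measurableI; [exact: mS | exact: mU].
Qed.

Lemma measurable_round_event i A : round_events S U i A -> measurable A.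
Proof.
case: i => t /= [B mB <-]; rewrite setTI; last exact: (mU t B).
have -> : (S t @^-1` B = \bigcup_(C in B) S t @^-1` [set C])%classic.
  by apply/seteqP; split => x /= => [BS|[C BC ->]//]; exists (S t x).
by apply: fin_bigcup_measurable => // C _; exact: mS.
Qed.

(* The family [E] of later events is arbitrary because the induction on [k]
   moves round [k - 1] into it, after splitting over the committee drawn. *)
Lemma rejection_prefix k (J : {fset nat + nat}) (E : nat + nat -> set T) :
  (forall i, i \in J -> round_events S U i (E i)) ->
  (forall t, (t < k)%N -> (inl t \notin J) && (inr t \notin J)) ->
  (P (rejected k `&` \bigcap_(i in [set` J]) E i)%classic =
   ((1 - q) ^+ k)%:E * \prod_(i <- J) P (E i))%E.
Proof.
case: (hrand) => _ _ _ indep.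
elim: k J E => [|k IH] J E hE hJ.
  rewrite (_ : rejected 0 = setT) ?setTI ?expr0 ?mul1e ?indep//.
  by apply/seteqP; split.
have /andP[kl kr] := hJ k (leqnn _).
(* Once the committee of round [k] is fixed to be [C], that round rejects exactly when [U k] is at
   least [ps C]. These two events join the family; their indices are new by [hJ]. *)
pose J' := (inl k |` (inr k |` J))%fset.
pose E' C i := if i == inl k then (S k @^-1` [set C])%classic else
  if i == inr k then (U k @^-1` ~` `]-oo, ps C[)%classic else E i.
have klr : inl k \notin (inr k |` J)%fset by rewrite !inE.
have EJ C i : i \in J -> E' C i = E i.
  rewrite /E'; case: eqP => [->|_]; first by rewrite (negPf kl).
  by case: eqP => // ->; rewrite (negPf kr).
have step C : (rejected k.+1 `&` \bigcap_(i in [set` J]) E i `&` S k @^-1` [set C] =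
    rejected k `&` \bigcap_(i in [set` J']) E' C i)%classic.
  rewrite !set_fsetU1 !bigcap_setU1 {1}/E' eqxx {1}/E' /= eqxx.
  rewrite (_ : \bigcap_(i in [set` J]) E' C i = \bigcap_(i in [set` J]) E i)%classic;
    last by apply: eq_bigcapr => i; exact: EJ.
  apply/seteqP; split => x /=.
    move=> [[rej EJx] SC]; split; first by move=> t tk; apply: rej; exact: ltnW.
    split => //; split => //; have := rej k (leqnn _).
    by rewrite /accepts SC in_itv /= => /negP.
  move=> [rej [SC [UC EJx]]]; split => //; split => // t.
  rewrite ltnS leq_eqVlt => /orP[/eqP ->|/rej//].
  by apply/negP => acc; apply: UC; rewrite /= in_itv /= /ps -SC.
rewrite (total_probability P (S k) (mS k)); last first.
  apply: measurableI; first exact: measurable_rejected.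
  by apply: fin_bigcap_measurable => // i /hE; exact: measurable_round_event.
have [r rE] : exists r, (\prod_(i <- J) P (E i) = r%:E)%E.
  rewrite -indep//; exists (fine (P (\bigcap_(i in [set` J]) E i)%classic)).
  rewrite fineK ?fin_num_measure//; apply: fin_bigcap_measurable => // i /hE.
  exact: measurable_round_event.
transitivity (\sum_C ((1 - q) ^+ k * (a C * (1 - ps C)) * r)%:E)%E.
  apply: eq_bigr => C _; rewrite step IH.
  - rewrite big_fsetU1//= big_fsetU1//= [E' C (inl k)]/E' eqxx [E' C (inr k)]/E' /= eqxx.
    rewrite (eq_big_seq (fun i => P (E i))); last by move=> i /(EJ C) ->.
    by rewrite rE [X in (_ * X)%E]muleA rejection_mass -!EFinM mulrA.
  - move=> i iJ; rewrite /E'; move: iJ; case: eqP => [-> _|+] /=.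
      by exists [set C]%classic; rewrite // setTI.
    case: eqP => [-> _|+] /=.
      by exists (~` `]-oo, ps C[)%classic; rewrite ?setTI//; exact: measurableC.
    move=> nr nl; rewrite !inE => /or3P[/eqP|/eqP|iJ] //; exact: hE.
  - move=> t tk; have /andP[tl tr] := hJ t (ltnW tk).
    by rewrite !inE (negPf tl) (negPf tr) !orbF /= /eq_op /= ltn_eqF.
rewrite sumEFin rE -EFinM; congr EFin.
(* The new factor is the rejection probability of one round: [a C * (1 - ps C)] sums to [1 - q]. *)
rewrite -mulr_suml -mulr_sumr exprSr; congr (_ * _ * _).
by under eq_bigr do rewrite mulrBr mulr1; rewrite sumrB sum_committee_mass.
Qed.

Definition accepted_at (C : {set 'I_N}) (t : nat) : set T :=
  (rejected t `&` (S t @^-1` [set C] `&` U t @^-1` `]-oo, ps C[))%classic.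

Lemma measurable_accepted_at C t : measurable (accepted_at C t).
Proof.
by do !apply: measurableI; [exact: measurable_rejected | exact: mS | exact: mU].
Qed.

Lemma probability_accepted_at C t :
  P (accepted_at C t) = ((1 - q) ^+ t * (a C * ps C))%:E.
Proof.
pose J := (inl t |` [fset inr t])%fset : {fset nat + nat}.
pose E (i : nat + nat) := if i is inl _ then (S t @^-1` [set C])%classic
  else (U t @^-1` `]-oo, ps C[)%classic.
have := @rejection_prefix t J E.
rewrite set_fsetU1 set_fset1 bigcap_setU1 bigcap_set1 => ->.
- by rewrite big_fsetU1 ?inE//= big_seq_fset1 acceptance_mass -EFinM.
- move=> i; rewrite !inE => /orP[]/eqP-> /=.
    by exists [set C]%classic; rewrite // setTI.
  by exists `]-oo, ps C[%classic; rewrite ?setTI.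
- by move=> s st; rewrite !inE /eq_op /= orbF /= ltn_eqF.
Qed.

(** Of two distinct rounds, the event of the later one says that the earlier one rejected. *)
Lemma trivIset_accepted_at C : trivIset setT (accepted_at C).
Proof.
have acc x t : accepted_at C t x -> accepts S U p x t.
  by case=> _ [/= SC]; rewrite /accepts SC in_itv.
apply/trivIsetP => s t _ _ st; apply/seteqP; split => // x [As At].
have := st; rewrite neq_ltn => /orP[lt|lt].
  by case: At => /(_ _ lt) /negP + _; apply; exact: acc.
by case: As => /(_ _ lt) /negP + _; apply; exact: acc.
Qed.

(** Countable additivity yields a geometric series, whose ratio [1 - q] lies in [[0, 1[]. *)
Lemma probability_accepted (C : {set 'I_N}) : 0 < q <= 1 ->
  P (\bigcup_t accepted_at C t)%classic = (a C * ps C / q)%:E.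
Proof.
move=> /andP[q0 q1].
rewrite measure_semi_bigcup; last 3 first.
- exact: measurable_accepted_at.
- exact: trivIset_accepted_at.
- by apply: bigcup_measurable => t _; exact: measurable_accepted_at.
have lt1 : `|1 - q| < 1 by rewrite ger0_norm ?subr_ge0// gtrBl.
rewrite (eq_eseriesr (fun t _ => probability_accepted_at C t)).
transitivity (limn (EFin \o series (geometric (a C * ps C) (1 - q)))).
  congr (limn _); apply/funext => k /=; rewrite sumEFin; congr EFin.
  by apply: eq_bigr => t _; rewrite mulrC.
rewrite EFin_lim; last exact: is_cvg_geometric_series.
have -> := cvg_lim (@Rhausdorff R) (cvg_geometric_series (a := a C * ps C) lt1).
by rewrite subKr.
Qed.

(** At most one indicator is nonzero, that of the committee drawn in the first accepting round; if
    no round accepts, both sides are 0. *)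
Lemma voting_powerE x n :
  run_voting_power (cumulative_rejection_sampling S U p x) n =
  \sum_(C : {set 'I_N}) (if n \in C then #|C|%:R^-1 else 0) *
     \1_(\bigcup_t accepted_at C t)%classic x :> R.
Proof.
rewrite /run_voting_power /cumulative_rejection_sampling.
case: pselect => [h|nacc]; last first.
  rewrite big1// => C _; rewrite indicE memNset ?mulr0// => -[t _ [_ [/= SC]]].
  by rewrite in_itv /= => lt; apply: nacc; exists t; rewrite /accepts SC.
case: ex_minnP => t acc tmin; rewrite (bigD1 (S t x))//= big1 => [|C CS].
  rewrite addr0 indicE mem_set ?mulr1.
    rewrite /voting_power /=; case: ifP => [nS|//].
    rewrite (eq_bigr (fun=> 1)) => [|i ->//].
    by rewrite sumr_const nS mul1r.
  exists t => //; split; last by split; rewrite //= in_itv.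
  move=> s st; apply/negP => /tmin; by rewrite leqNgt st.
rewrite indicE memNset ?mulr0// => -[s _ [rej [/= SC]]]; rewrite in_itv /= => lt.
have accs : accepts S U p x s by rewrite /accepts SC.
(* If [t = s], then [C] is [S t x], which was excluded; if [t < s], then round [t] was rejected,
   against [acc]. *)
have := tmin _ accs; rewrite leq_eqVlt => /orP[/eqP ts|/rej].
  by move/eqP: CS; apply; rewrite ts SC.
by rewrite acc.
Qed.

(** [a C] vanishes unless [#|C| = M], so [1 / #|C|] becomes the constant [1 / M]. *)
Lemma expected_voting_power n : 0 < q <= 1 ->
  'E_P[fun x => run_voting_power (cumulative_rejection_sampling S U p x) n]%E =
  (\sum_(C : {set 'I_N} | (n \in C) && (#|C| == M))
     ps C / (M%:R * 'C(N, M)%:R * q))%:E.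
Proof.
move=> q01; under [X in expectation.body _ X]eq_fun do rewrite voting_powerE.
rewrite expectation_sum_indic.
- under eq_bigr do rewrite probability_accepted// -EFinM.
  rewrite sumEFin; congr EFin; rewrite [RHS]big_mkcond; apply: eq_bigr => C _.
  rewrite /a; case: (n \in C); rewrite /= ?mul0r//.
  case: eqP => [->|_]; last by rewrite !mul0r mulr0.
  by rewrite !invfM; ring.
- by move=> C; case: ifP => // _; rewrite invr_ge0.
- by move=> C; apply: bigcup_measurable => t _; exact: measurable_accepted_at.
Qed.

End RejectionSampling.

Theorem proposition4p3 (R : realType) (N M : nat) (w p : 'I_N -> R)
    (d : measure_display) (T : measurableType d) (P : probability T R)
    (S : nat -> T -> {set 'I_N}) (U : nat -> {RV P >-> R})
    (hM : (2 < M)%N) (hN : (M < N)%N)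
    (w_gt0 : forall i, 0 < w i) (w_sum1 : \sum_i w i = 1)
    (w_bounds : forall i,
       (M%:R - 1) / (M%:R * (N%:R - 1)) <= w i
         <= (N%:R - 2 * M%:R + M%:R ^+ 2) / (M%:R ^+ 2 * (N%:R - 1)))
    (hp : forall i,
       p i = M%:R * (N%:R - 1) / (N%:R - M%:R) * w i
             - (M%:R - 1) / (N%:R - M%:R))
    (hrand : crs_randomness S U M) :
  fair P (cumulative_rejection_sampling S U p) w.
Proof.
have N1 : (1 < N)%N by exact: leq_trans (ltnW hM) (ltnW hN).
have M0 : 0 < M%:R :> R by rewrite ltr0n (leq_trans _ hM).
have NM : 0 < N%:R - M%:R :> R by rewrite subr_gt0 ltr_nat.
have N0 : 0 < N%:R - 1 :> R by rewrite subr_gt0 ltr1n.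
have M0' : M%:R != 0 :> R by rewrite gt_eqF.
have NM' : N%:R - M%:R != 0 :> R by rewrite gt_eqF.
have N0' : N%:R - 1 != 0 :> R by rewrite gt_eqF.
have Np : N%:R != 0 :> R by rewrite pnatr_eq0 -lt0n ltnW.
have p01 i : 0 <= p i <= M%:R^-1.
  have /andP[lo hi] := w_bounds i.
  (* As affine functions of [w i], [p i] vanishes at the lower bound and [1 / M - p i] at the upper
     one. *)
  have pE : p i = M%:R * (N%:R - 1) / (N%:R - M%:R) *
      (w i - (M%:R - 1) / (M%:R * (N%:R - 1))).
    by rewrite hp; field; rewrite M0' NM' N0'.
  have pE' : M%:R^-1 - p i = M%:R * (N%:R - 1) / (N%:R - M%:R) *
      ((N%:R - 2 * M%:R + M%:R ^+ 2) / (M%:R ^+ 2 * (N%:R - 1)) - w i).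
    by rewrite hp; field; rewrite M0' NM' N0'.
  have c0 : 0 <= M%:R * (N%:R - 1) / (N%:R - M%:R) :> R.
    by rewrite divr_ge0 ?mulr_ge0 ?ltW.
  apply/andP; split; last rewrite -subr_ge0 pE'; rewrite ?pE mulr_ge0 ?subr_ge0//.
(* The sum is [(M (N - 1) - N (M - 1)) / (N - M)], with numerator [N - M]. *)
have psum : \sum_i p i = 1.
  under eq_bigr do rewrite hp.
  rewrite sumrB -mulr_sumr w_sum1 sumr_const card_ord -mulr_natr.
  by field.
have pC01 (C : {set 'I_N}) : #|C| = M -> 0 <= \sum_(j in C) p j <= 1.
  move=> CM; apply/andP; split; first by apply: sumr_ge0 => i _; case/andP: (p01 i).
  have -> : 1 = \sum_(j in C) M%:R^-1 :> R by rewrite sumr_const CM -[RHS]mulr_natr mulVf.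
  by apply: ler_sum => i _; case/andP: (p01 i).
(* [K], [K1] and [K2] count the committees containing zero, one and two prescribed participants. *)
set K : R := 'C(N, M)%:R; pose K1 : R := 'C(N - 1, M - 1)%:R.
pose K2 : R := 'C(N - 2, M - 2)%:R.
have K0 : K != 0 by rewrite pnatr_eq0 -lt0n bin_gt0 ltnW.
have K1E : K1 = M%:R * K / N%:R.
  apply: (canRL (mulfK Np)); rewrite mulrC -!natrM; congr _%:R.
  by have := mul_bin_diag N M.-1; rewrite prednK ?(leq_trans _ hM)// !subn1.
have K2E : K2 = (M%:R - 1) * K1 / (N%:R - 1).
  apply: (canRL (mulfK N0')); rewrite mulrC.
  have M1 : (1 <= M)%N by exact: leq_trans hM.
  rewrite -(natrB _ (ltnW N1)) -(natrB _ M1) -!natrM; congr _%:R.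
  have := mul_bin_diag (N - 1) (M - 2).
  by rewrite -subnS subnSK// (leq_trans _ hM).
have cardn (B : {set 'I_N}) : (#|B| <= 2)%N ->
    #|[set C : {set 'I_N} | (B \subset C) && (#|C| == M)]| =
    'C(N - #|B|, M - #|B|).
  by move=> B2; rewrite card_supset_draws ?card_ord// (leq_trans B2)// ltnW.
(* Double counting with [B] empty: each [j] lies in [K1] committees, so the acceptance probability
   is [K1 / K]. *)
have qE : \sum_(C : {set 'I_N})
    (if #|C| == M then K^-1 else 0) * \sum_(j in C) p j = M%:R / N%:R.
  transitivity (K^-1 * \sum_(C : {set 'I_N} | (finset.set0 \subset C) && (#|C| == M))
      \sum_(j in C) p j).
    rewrite mulr_sumr [RHS]big_mkcond; apply: eq_bigr => C _.
    by rewrite finset.sub0set /=; case: ifP => _; rewrite ?mul0r.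
  rewrite sum_supset_draws (eq_bigr (fun j => p j * K1)) => [|j _].
    by rewrite -mulr_suml psum K1E; field; rewrite Np K0.
  by rewrite finset.setU0 cardn cards1.
move=> n; rewrite (expected_voting_power _ _ _ _ _ hrand pC01) qE; last first.
  have Ngt0 : 0 < N%:R :> R by rewrite ltr0n ltnW.
  by rewrite divr_gt0//= ler_pdivrMr// mul1r ler_nat ltnW.
congr EFin; rewrite -mulr_suml.
(* Double counting with [B] reduced to [n]: [p n] is counted [K1] times, and every other [p j], of
   total [1 - p n], is counted [K2] times. *)
transitivity ((p n * K1 + (1 - p n) * K2) / (M%:R * K * (M%:R / N%:R))).
  congr (_ / _); under eq_bigl do rewrite -finset.sub1set.
  rewrite sum_supset_draws (bigD1 n)//= finset.setUid cardn ?cards1//; congr (_ + _).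
  have -> : 1 - p n = \sum_(j | j != n) p j.
    by rewrite -psum (bigD1 n)//= addrAC subrr add0r.
  rewrite mulr_suml.
  by apply: eq_bigr => j jn; rewrite cardn cards2 jn.
rewrite K2E K1E hp; field.
by rewrite ?M0' ?N0' ?NM' ?Np ?K0.
Qed.
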